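(* Let $q > 3$ be a prime power, and let $\phi, \rho, \psi$ be (not necessarily distinct) primitive elements of the finite field $\mathbb{F}_q$. Then the $(q-2)\times(q-2)\times(q-2)$ array $D = (d_{i,j,k})$ with entries in $\{0,1\}$ given by $$d_{i,j,k} = I\big[\phi^i + \rho^{-j} = 1 \ \text{ and }\ \phi^{-i} + \psi^{k} = 1 \ \text{ and }\ \rho^j + \psi^{-k} = 1\big] \quad \text{for } i,j,k \in \{1,2,\dots,q-2\}$$ is an order $q-2$ Costas cube for which Projection $A$ is the $G_2(q,\phi,\rho^{-1})$ Golomb Costas array, Projection $B$ is the $G_2(q,\phi^{-1},\psi)$ Golomb Costas array, and Projection $C$ is the $G_2(q,\rho,\psi^{-1})$ Golomb Costas array.
   Context: $I[X]$ denotes the indicator of condition $X$ ($1$ if $X$ is true, $0$ otherwise). A primitive element of $\mathbb{F}_q$ is a generator of the multiplicative group $\mathbb{F}_q^*$. The equations inside the indicator functions are equations in $\mathbb{F}_q$. An order $n$ permutation array is an $n\times n$ array $(s_{i,j})$, with $i,j\in\{1,\dots,n\}$, of the form $s_{i,j} = I[\sigma(j)=i]$ for a permutation $\sigma$ of $\{1,\dots,n\}$. It is an order $n$ Costas array if the vectors joining pairs of $1$ entries are all distinct: whenever $(P,Q)$ and $(P',Q')$ are different ordered pairs of distinct positions, all containing $1$ entries, then $Q-P \ne Q'-P'$ in $\mathbb{Z}^2$. The projections of a three-dimensional array $(d_{i,j,k})$ are Projection $A = (a_{i,j}) = (\sum_k d_{i,j,k})$, Projection $B = (b_{i,k}) =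 (\sum_j d_{i,j,k})$, and Projection $C = (c_{j,k}) = (\sum_i d_{i,j,k})$. An order $n$ Costas cube is an $n\times n\times n$ array with entries in $\{0,1\}$ (an ''array over $\mathbb{Z}_2$'') for which Projections $A$, $B$, $C$ are each order $n$ Costas arrays. For $\alpha,\beta$ primitive elements of $\mathbb{F}_q$ (not necessarily distinct), the $G_2(q,\alpha,\beta)$ Golomb Costas array is the $(q-2)\times(q-2)$ array $(s_{i,j})$ given by $s_{i,j} = I[\alpha^i+\beta^j=1]$ for $i,j\in\{1,\dots,q-2\}$ (classically known to be an order $q-2$ Costas array for $q>3$). *)

(* Defs.v *)
From mathcomp Require Import all_boot all_order all_algebra all_fingroup all_solvable.

Set Implicit Arguments.
Unset Strict Implicit.
Unset Printing Implicit Defensive.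

Import GRing.Theory.
Local Open Scope ring_scope.

(* Indices: the mathematical index set {1, ..., n} is represented by 'I_n, with
   i : 'I_n standing for the index i.+1.  Entries of arrays are natural numbers,
   so that projections are sums of integers (not sums modulo 2). *)

Definition array3 (n : nat) := 'I_n -> 'I_n -> 'I_n -> nat.

Definition permutation_array (n : nat) (M : 'M[nat]_n) : Prop :=
  exists s : 'S_n, M = \matrix_(i, j) nat_of_bool (s j == i).

(* Q - P in Z^2; the shift between 'I_n and {1, ..., n} cancels out. *)
Definition displacement (n : nat) (P Q : 'I_n * 'I_n) : int * int :=
  ((Q.1 : nat)%:Z - (P.1 : nat)%:Z, (Q.2 : nat)%:Z - (P.2 : nat)%:Z).

Definition costas_array (n : nat) (M : 'M[nat]_n) : Prop :=
  permutation_array M /\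
  forall P Q P' Q' : 'I_n * 'I_n,
    P <> Q -> P' <> Q' ->
    M P.1 P.2 = 1%N -> M Q.1 Q.2 = 1%N ->
    M P'.1 P'.2 = 1%N -> M Q'.1 Q'.2 = 1%N ->
    (P, Q) <> (P', Q') ->
    displacement P Q <> displacement P' Q'.

Definition projA (n : nat) (d : array3 n) : 'M[nat]_n :=
  \matrix_(i, j) (\sum_(k < n) d i j k)%N.
Definition projB (n : nat) (d : array3 n) : 'M[nat]_n :=
  \matrix_(i, k) (\sum_(j < n) d i j k)%N.
Definition projC (n : nat) (d : array3 n) : 'M[nat]_n :=
  \matrix_(j, k) (\sum_(i < n) d i j k)%N.

Definition costas_cube (n : nat) (d : array3 n) : Prop :=
  [/\ forall i j k, d i j k = 0%N \/ d i j k = 1%N,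
      costas_array (projA d),
      costas_array (projB d)
    & costas_array (projC d)].

Definition primitive_element (F : finFieldType) (x : F) : Prop :=
  exists2 u : {unit F}, val u = x & generator [set: {unit F}] u.

(* Intended for #|F| = q; the order q is kept as a separate parameter so that it
   determines the size of the array. *)
Definition is_golomb_costas2 (q : nat) (F : finFieldType) (a b : F)
    (M : 'M[nat]_(q - 2)) : Prop :=
  [/\ primitive_element a, primitive_element b
    & M = \matrix_(i, j) nat_of_bool (a ^+ i.+1 + b ^+ j.+1 == 1)].

(* Main.v *)
Require Import Defs.
From mathcomp Require Import all_boot all_order all_algebra all_fingroup all_solvable.
From mathcomp Require Import finfield zify ring.

Import GRing.Theory.

Local Open Scope ring_scope.

(** Write [x = phi ^ i], [y = rho ^ j], [z = psi ^ k].  As the indices run over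
    [1, ..., q - 2], each of [x], [y], [z] takes every value of [F] other than 0
    and 1 exactly once.  With [g t = 1 / (1 - t)] the three equations defining
    the cube say [y = g x], [z = g y] and [x = g z].  Since [g] permutes
    [F \ {0, 1}] and has order 3, any one of the equations can be completed by
    exactly one value of the missing variable, and the two others then hold
    ([sum_third_coordinate]).  So summing along an axis leaves just the equation
    that does not involve the summed variable, which is a Golomb array.  The
    system is invariant under rotating [x], [y], [z], so one computation serves
    all three projections.

    That a Golomb array is Costas ([golomb_costas]) is an instance of Vieta's
    formulas.  If the vectors from point 1 to point 2 and from point 3 to
    point 4 agree, the abscissae [x_n = a ^ i_n] satisfy [x2 x3 = x1 x4], and
    likewise [(1 - x2) (1 - x3) = (1 - x1) (1 - x4)] for the ordinates.  Hence
    [x2 + x3 = x1 + x4] too, so [x1] is [x2] or [x3]: either the vectors vanish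
    or the two pairs of points coincide. *)

Lemma primitive_neq0 (F : finFieldType) (a : F) : primitive_element a -> a != 0.
Proof. by case=> u <- _; rewrite -unitfE; exact: (valP u). Qed.

Lemma primitive_inv (F : finFieldType) (a : F) :
  primitive_element a -> primitive_element a^-1.
Proof.
case=> u <- gen_u; exists u^-1%g; first by rewrite FinRing.val_unitV.
by move: gen_u; rewrite /generator cycleV.
Qed.

Lemma primitive_order (F : finFieldType) (u : {unit F}) :
  generator [set: {unit F}] u -> #[u]%g = #|F|.-1.
Proof. by move/eqP=> gen_u; rewrite orderE -gen_u card_finField_unit. Qed.

Lemma primitive_exp_inj (F : finFieldType) (a : F) : primitive_element a ->
  injective (fun i : 'I_(#|F| - 2) => a ^+ i.+1).
Proof.
case=> u <- /primitive_order ord_u i j /=.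
rewrite -!FinRing.val_unitX => /val_inj/eqP.
have small (k : 'I_(#|F| - 2)) : (k.+1 %% #|F|.-1)%N = k.+1.
  by apply: modn_small; have := ltn_ord k; lia.
rewrite eq_expg_mod_order ord_u !small.
by move/eqP=> [eq_ij]; exact: val_inj.
Qed.

Lemma primitive_exp_neq1 (F : finFieldType) (a : F) (i : 'I_(#|F| - 2)) :
  primitive_element a -> a ^+ i.+1 != 1.
Proof.
case=> u <- /primitive_order ord_u.
rewrite -FinRing.val_unitX; apply/eqP; rewrite -FinRing.val_unit1 => /val_inj/eqP.
rewrite -order_dvdn ord_u => /(dvdn_leq (ltn0Sn i)); have := ltn_ord i; lia.
Qed.

Lemma primitive_exp_surj (F : finFieldType) (a x : F) :
  primitive_element a -> x != 0 -> x != 1 ->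
  exists i : 'I_(#|F| - 2), a ^+ i.+1 = x.
Proof.
case=> u <- gen_u; rewrite -unitfE => unit_x x_neq1.
have ord_u := primitive_order F u gen_u.
have : FinRing.unit F unit_x \in <[u]>%g by rewrite -(eqP gen_u) inE.
case/cyclePmin=> [[|i]] lt_i /(congr1 val) /= def_x.
  (* The exponent 0 gives 1, so the others are exactly 1, ..., q - 2. *)
  by rewrite def_x eqxx in x_neq1.
have lt_i' : (i < #|F| - 2)%N by move: lt_i; rewrite ord_u; lia.
by exists (Ordinal lt_i'); rewrite def_x FinRing.val_unitX.
Qed.

Lemma onem_neq1 (R : comNzRingType) (x : R) : x != 0 -> 1 - x != 1.
Proof.
apply: contra_neq => eq_1.
by have -> : x = 1 - (1 - x) by [ring]; rewrite eq_1 subrr.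
Qed.

Definition golomb_array (F : finFieldType) (a b : F) : 'M[nat]_(#|F| - 2) :=
  \matrix_(i, j) nat_of_bool (a ^+ i.+1 + b ^+ j.+1 == 1).

Lemma golomb_arrayP (F : finFieldType) (a b : F) i j :
  golomb_array F a b i j = 1%N -> b ^+ j.+1 = 1 - a ^+ i.+1.
Proof. by rewrite mxE; case: eqP => // <- _; rewrite addrC addKr. Qed.

(** The map [t |-> 1 - t] preserves [F \ {0, 1}], so every column of the array
    meets exactly one row. *)
Lemma golomb_permutation (F : finFieldType) (a b : F) :
  primitive_element a -> primitive_element b ->
  permutation_array (golomb_array F a b).
Proof.
move=> prim_a prim_b.
have row_of (j : 'I_(#|F| - 2)) : {i : 'I_(#|F| - 2) | a ^+ i.+1 == 1 - b ^+ j.+1}.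
  apply: sigW.
  have [|| i def_i] := @primitive_exp_surj F a (1 - b ^+ j.+1) prim_a.
  - by rewrite subr_eq0 eq_sym primitive_exp_neq1.
  - exact/onem_neq1/expf_neq0/primitive_neq0.
  - by exists i; rewrite def_i.
have s_inj : injective (fun j : 'I_(#|F| - 2) => sval (row_of j)).
  move=> j j' /= eq_s; apply: (primitive_exp_inj F b prim_b) => /=.
  apply: oppr_inj; apply: (addrI 1).
  by rewrite -(eqP (svalP (row_of j))) eq_s (eqP (svalP (row_of j'))).
exists (perm s_inj); apply/matrixP=> i j; rewrite !mxE permE.
have /eqP def_s := svalP (row_of j).
congr nat_of_bool; apply/eqP/eqP => [eq_1 | <-]; last by rewrite def_s subrK.
apply: (primitive_exp_inj F a prim_a) => /=.
by rewrite def_s -eq_1 addrK.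
Qed.

Lemma golomb_array_row (F : finFieldType) (a b : F) i j j' :
  primitive_element b ->
  golomb_array F a b i j = 1%N -> golomb_array F a b i j' = 1%N -> j = j'.
Proof.
move=> prim_b /golomb_arrayP eq_j /golomb_arrayP eq_j'.
by apply: (primitive_exp_inj F b prim_b) => /=; rewrite eq_j eq_j'.
Qed.

(** The polynomials [(X - x2) (X - x3)] and [(X - x1) (X - x4)] have the same
    coefficients, and [x1] is a root of the second. *)
Lemma vieta_pair (R : idomainType) (x1 x2 x3 x4 : R) :
  x2 * x3 = x1 * x4 -> x2 + x3 = x1 + x4 -> x1 = x2 \/ x1 = x3.
Proof.
move=> eq_prod eq_sum.
have : (x1 - x2) * (x1 - x3) == 0.
  have -> : (x1 - x2) * (x1 - x3) = x1 * (x1 - (x2 + x3)) + x2 * x3 by ring.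
  by rewrite eq_prod eq_sum; apply/eqP; ring.
by rewrite mulf_eq0 !subr_eq0 => /orP[] /eqP; [left | right].
Qed.

(** Without subtraction, an equality of displacements turns into an equality
    between products of powers. *)
Lemma displacement_exchange (n : nat) (P Q P' Q' : 'I_n * 'I_n) :
  displacement P Q = displacement P' Q' ->
  (Q.1 + P'.1 = P.1 + Q'.1)%N /\ (Q.2 + P'.2 = P.2 + Q'.2)%N.
Proof.
have exchange (m m' p p' : nat) : m%:Z - p%:Z = m'%:Z - p'%:Z ->
    (m + p' = p + m')%N by lia.
by case=> /exchange-> /exchange->.
Qed.

Lemma golomb_costas (F : finFieldType) (a b : F) :
  primitive_element a -> primitive_element b ->
  costas_array (golomb_array F a b).
Proof.
move=> prim_a prim_b; split; first exact: golomb_permutation.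
move=> [i1 j1] [i2 j2] [i3 j3] [i4 j4] /= neq_PQ _ M1 M2 M3 M4 neq_pairs.
case/displacement_exchange=> /= eq_i eq_j.
have eq_prod : a ^+ i2.+1 * a ^+ i3.+1 = a ^+ i1.+1 * a ^+ i4.+1.
  by rewrite -!exprD !addSn !addnS eq_i.
have eq_prod1 : (1 - a ^+ i2.+1) * (1 - a ^+ i3.+1) =
                (1 - a ^+ i1.+1) * (1 - a ^+ i4.+1).
  rewrite -(golomb_arrayP F a b i1 j1 M1) -(golomb_arrayP F a b i2 j2 M2).
  rewrite -(golomb_arrayP F a b i3 j3 M3) -(golomb_arrayP F a b i4 j4 M4).
  by rewrite -!exprD !addSn !addnS eq_j.
have eq_sum : a ^+ i2.+1 + a ^+ i3.+1 = a ^+ i1.+1 + a ^+ i4.+1.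
  have sumE x y : x + y = 1 + x * y - (1 - x) * (1 - y) :> F by ring.
  by rewrite sumE eq_prod eq_prod1 -sumE.
have [/(primitive_exp_inj F a prim_a) | /(primitive_exp_inj F a prim_a)] :=
  vieta_pair F _ _ _ _ eq_prod eq_sum => eq_i1.
  rewrite eq_i1 in M1 neq_PQ.
  by apply: neq_PQ; rewrite (golomb_array_row F a b i2 j1 j2).
rewrite eq_i1 in M1 eq_i neq_pairs.
have eq_j1 : j1 = j3 by exact: (golomb_array_row F a b i3).
rewrite eq_j1 in eq_j neq_pairs.
apply: neq_pairs.
have -> : i2 = i4 by apply: val_inj; move: eq_i; rewrite addnC => /addnI.
by have -> : j2 = j4 by apply: val_inj; move: eq_j; rewrite addnC => /addnI.
Qed.

(** The equations say that [t |-> 1 - 1 / t], a map of order 3, sends [y] to [x],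
    [x] to [z] and [z] to [y]: two of these steps imply the third. *)
Lemma triple_completion (F : fieldType) (x y z : F) :
  x != 0 -> y != 0 -> z != 0 ->
  [&& x + y^-1 == 1, x^-1 + z == 1 & y + z^-1 == 1]
    = (x + y^-1 == 1) && (z == 1 - x^-1).
Proof.
move=> x_neq0 y_neq0 z_neq0.
have -> : (x^-1 + z == 1) = (z == 1 - x^-1) by rewrite addrC -subr_eq opprK.
have [eq_xy | //] := eqVneq (x + y^-1) 1; have [eq_z | //] := eqVneq z.
have y_neq1 : y - 1 != 0.
  apply: contra_neq x_neq0 => /eqP; rewrite subr_eq0 => /eqP y1.
  by move: eq_xy; rewrite y1 invr1 -[X in _ = X]add0r => /addIr.
have def_x : x = (y - 1) / y by rewrite -[x](addrK y^-1) eq_xy; field.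
have def_z : z = - (y - 1)^-1.
  by rewrite eq_z def_x; field; rewrite y_neq0 y_neq1.
by rewrite def_z invrN invrK opprB addrC subrK eqxx.
Qed.

(** The third coordinate forced by the first equation is again neither 0 nor 1,
    hence it is the power [c ^ k] for exactly one index [k]. *)
Lemma sum_third_coordinate (F : finFieldType) (c x y : F) :
  primitive_element c -> x != 0 -> y != 0 ->
  (\sum_(k < #|F| - 2)
     nat_of_bool ([&& x + y^-1 == 1, x^-1 + c ^+ k.+1 == 1
                    & y + c ^- k.+1 == 1])%R)%N
  = nat_of_bool (x + y^-1 == 1).
Proof.
move=> prim_c x_neq0 y_neq0.
have c_neq0 k : c ^+ k != 0 by exact/expf_neq0/primitive_neq0.
under eq_bigr => k _ do rewrite triple_completion //.
have [eq_xy | _] := eqVneq (x + y^-1) 1; last by rewrite big1.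
have x_neq1 : x != 1.
  apply: contra_neq (invr_neq0 y_neq0) => x1.
  by apply: (addrI 1); rewrite addr0 -[in LHS]x1.
have [|| k0 def_k0] := @primitive_exp_surj F c (1 - x^-1) prim_c.
- by rewrite subr_eq0 eq_sym invr_eq1.
- exact/onem_neq1/invr_neq0.
rewrite (bigD1 k0) //= def_k0 eqxx big1 // => k neq_k.
rewrite -def_k0; case: eqP => // /(primitive_exp_inj F c prim_c) eq_k.
by rewrite eq_k eqxx in neq_k.
Qed.

Theorem theorem7 (q : nat) (hq : (3 < q)%N) (F : finFieldType) (hF : #|F| = q)
    (phi rho psi : F)
    (hphi : primitive_element phi) (hrho : primitive_element rho)
    (hpsi : primitive_element psi) :
  let D : array3 (q - 2) := fun i j k =>
    nat_of_bool [&& phi ^+ i.+1 + rho ^- j.+1 == 1,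
                    phi ^- i.+1 + psi ^+ k.+1 == 1
                  & rho ^+ j.+1 + psi ^- k.+1 == 1] in
  [/\ costas_cube D,
      is_golomb_costas2 phi rho^-1 (projA D),
      is_golomb_costas2 phi^-1 psi (projB D)
    & is_golomb_costas2 rho psi^-1 (projC D)].
Proof.
subst q => D.
have phi_neq0 i : phi ^+ i != 0 by exact/expf_neq0/primitive_neq0.
have rho_neq0 i : rho ^+ i != 0 by exact/expf_neq0/primitive_neq0.
have psi_neq0 i : psi ^+ i != 0 by exact/expf_neq0/primitive_neq0.
have defA : projA D = golomb_array F phi rho^-1.
  apply/matrixP=> i j; rewrite !mxE exprVn.
  exact: sum_third_coordinate.
(* The other two projections follow after rotating the roles of the powers of
   phi, rho and psi. *)
have defB : projB D = golomb_array F phi^-1 psi.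
  apply/matrixP=> i k; rewrite !mxE exprVn addrC.
  rewrite -(sum_third_coordinate F rho) //; apply: eq_bigr => j _.
  rewrite /D andbC -andbA [phi ^- _ + _]addrC [rho ^+ _ + _]addrC.
  by rewrite [phi ^+ _ + _]addrC; congr nat_of_bool; do !case: (_ == _).
have defC : projC D = golomb_array F rho psi^-1.
  apply/matrixP=> j k; rewrite !mxE exprVn.
  rewrite -(sum_third_coordinate F phi) //; apply: eq_bigr => i _.
  rewrite /D [phi ^- _ + _]addrC [phi ^+ _ + _]addrC.
  by congr nat_of_bool; do !case: (_ == _).
have [phiV rhoV psiV] :
  [/\ primitive_element phi^-1, primitive_element rho^-1
    & primitive_element psi^-1] by split; exact: primitive_inv.
split; [split | by split | by split | by split].
- by move=> i j k; rewrite /D; case: [&& _, _ & _]; [right | left].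
- by rewrite defA; exact: golomb_costas.
- by rewrite defB; exact: golomb_costas.
- by rewrite defC; exact: golomb_costas.
Qed.
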